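(* Let $(A,\mathfrak m)$ be a Noetherian local ring with $\dim A>0$ and let $I$ be a regular ideal of $A$. Then: (i) for all integers $n\ge 1$ and $t\ge 0$ with $t\ge \operatorname{reg}R(I)-n$, one has $\widetilde{I^n}=I^{n+t}:I^t$; (ii) $s^*(I)\le\max\{\operatorname{reg}R(I),\,1\}$.
   Context: An ideal $I$ is regular if it contains a non-zerodivisor of $A$. The Ratliff-Rush closure of an ideal $K$ is $\tilde K:=\bigcup_{m\ge 1}(K^{m+1}:K^m)$; for $K=I^n$ with $n\ge1$ one has $\widetilde{I^n}=\bigcup_{t\ge 0}(I^{n+t}:I^t)$ (with $I^0=A$). $s^*(I)$ denotes the least integer $m\ge 1$ such that $\widetilde{I^n}=I^n$ for all $n\ge m$. $R(I)=\bigoplus_{n\ge 0}I^n$ is the Rees algebra, a standard graded algebra over $A$. For a standard graded algebra $R$ over a commutative ring, let $R_+$ be the ideal generated by the elements of positive degree, put $a_i(R)=\max\{n\mid H^i_{R_+}(R)_n\ne 0\}$ (with $a_i(R)=-\infty$ if the local cohomology module $H^i_{R_+}(R)$ is zero), and define $\operatorname{reg}R=\max\{a_i(R)+i\mid i\ge 0\}$. *)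

(* Defs.v *)
From HB Require Import structures.
From mathcomp Require Import all_boot all_order all_algebra.
From mathcomp Require Import boolp classical_sets constructive_ereal.

Set Implicit Arguments.
Unset Strict Implicit.
Unset Printing Implicit Defensive.

Import Order.TTheory GRing.Theory Num.Theory.
Local Open Scope classical_set_scope.
Local Open Scope ring_scope.

(* [\bar int] is Z with -oo and +oo adjoined.  It is a complete lattice, so  *)
(* that [supremum] and [infimum] never fall back on their default value for  *)
(* a nonempty set; the defaults below are those of the empty set.            *)
Definition zsup (S : set (\bar int)) : \bar int := supremum -oo%E S.
Definition zinf (S : set (\bar int)) : \bar int := infimum +oo%E S.

Lemma int_has_max (S : set int) (b : int) :
  S !=set0 -> ubound S b -> exists2 m, S m & ubound S m.
Proof.
move=> [x Sx] ub.
have [k kP] : exists n : nat, b <= x + n%:Z.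
  by exists `|b - x|%N; rewrite -lerBlDl abszE ler_norm.
elim: k x Sx kP => [|k IH] x Sx kP.
  by exists x => // y /ub yb; rewrite (le_trans yb)// -[x]addr0.
have [ubx|] := pselect (ubound S x); first by exists x.
move=> /existsNP[y /not_implyP[Sy /negP]]; rewrite -ltNge => xy.
apply: (IH y Sy); apply: (le_trans kP).
by rewrite -addn1 addnC PoszD addrA lerD2r lezD1.
Qed.

Lemma supremums_neq0 (S : set (\bar int)) : supremums S !=set0.
Proof.
have [Sy|Sny] := pselect (S +oo%E).
  exists +oo%E; split; first by move=> x _; exact: leey.
  by move=> y /(_ _ Sy).
pose T := [set n : int | S n%:E].
have [[x Tx]|T0] := pselect (T !=set0); last first.
  exists -oo%E; split; last by move=> y _; exact: leNye.
  by move=> [x|//|_ //] Sx; case: T0; exists x.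
have [[b ub]|nub] := pselect (ubound T !=set0).
  have [m Tm ubm] := int_has_max (ex_intro _ _ Tx) ub.
  exists m%:E; split; last by move=> y /(_ _ Tm).
  by move=> [y /ubm|//|_]; rewrite ?lee_fin// leNye.
exists +oo%E; split; first by move=> y _; exact: leey.
move=> [y|//|] /= uy; last by have := uy _ Tx.
by case: nub; exists y => z /uy; rewrite lee_fin.
Qed.

Lemma infimums_neq0 (S : set (\bar int)) : infimums S !=set0.
Proof.
have [y [ub lb]] := supremums_neq0 (lbound S).
exists y; split=> // x Sx.
by apply: lb => z; apply.
Qed.

Section Ideals.
Variable A : comNzRingType.
Implicit Types (I J K P : set A).

Definition is_ideal J : Prop :=
  [/\ J 0, forall x y, J x -> J y -> J (x + y) & forall a x, J x -> J (a * x)].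

Definition ideal_gen (S : set A) : set A := smallest is_ideal S.

Definition ideal_mul J K : set A := ideal_gen [set x * y | x in J & y in K].

Fixpoint ideal_pow J (n : nat) : set A :=
  if n is m.+1 then ideal_mul J (ideal_pow J m) else setT.

Definition colon J K : set A := [set x | forall y, K y -> J (x * y)].

Definition prime_ideal P : Prop :=
  [/\ is_ideal P, ~ P 1 & forall x y, P (x * y) -> P x \/ P y].

Definition maximal_ideal P : Prop :=
  [/\ is_ideal P, ~ P 1 &
      forall J, is_ideal J -> ~ J 1 -> P `<=` J -> J = P].

Definition noetherian : Prop :=
  forall J, is_ideal J -> exists s : seq A, J = ideal_gen [set` s].

Definition local_ring (m : set A) : Prop :=
  maximal_ideal m /\ forall m', maximal_ideal m' -> m' = m.

Definition krull_dim : \bar int :=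
  zsup [set d | exists (n : nat) (p : nat -> set A),
    [/\ d = n%:Z%:E, forall i, (i <= n)%N -> prime_ideal (p i) &
        forall i, (i < n)%N -> p i `<` p i.+1]].

Definition regular_ideal J : Prop := is_ideal J /\ exists2 x, J x & GRing.lreg x.

Definition ratliff_rush K : set A :=
  \bigcup_(m in [set m | (1 <= m)%N]) colon (ideal_pow K m.+1) (ideal_pow K m).

Definition s_star I : \bar int :=
  zinf [set d | exists m : nat, [/\ d = m%:Z%:E, (1 <= m)%N &
    forall n, (m <= n)%N -> ratliff_rush (ideal_pow I n) = ideal_pow I n]].

End Ideals.

(* [V] is the internal direct sum of the subgroups [G j]. *)
Definition is_grading (V : zmodType) (T : choiceType) (G : T -> set V) : Prop :=
  [/\ forall j, G j 0 /\ forall x y, G j x -> G j y -> G j (x - y),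
      forall x, exists (s : seq T) (c : T -> V),
        [/\ uniq s, forall j, G j (c j) & x = \sum_(j <- s) c j]
    & forall (s : seq T) (c : T -> V), uniq s -> (forall j, G j (c j)) ->
        \sum_(j <- s) c j = 0 -> forall j, j \in s -> c j = 0].

Record gradedRing := GradedRing {
  gr_ring :> comNzRingType;
  gr_deg : nat -> set gr_ring;
  gr_grading : is_grading gr_deg;
  gr_deg1 : gr_deg 0%N 1;
  gr_degM : forall i j x y,
    gr_deg i x -> gr_deg j y -> gr_deg (i + j)%N (x * y) }.
Arguments gr_deg : clear implicits.

Definition irrelevant_ideal (R : gradedRing) : set R :=
  ideal_gen (\bigcup_(n in [set n | (0 < n)%N]) gr_deg R n).
Arguments irrelevant_ideal : clear implicits.

Record gradedModule (R : gradedRing) := GradedModule {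
  gm_mod :> lmodType R;
  gm_deg : int -> set gm_mod;
  gm_grading : is_grading gm_deg;
  gm_degZ : forall i k (a : R) x,
    gr_deg R i a -> gm_deg k x -> gm_deg (i%:Z + k) (a *: x) }.
Arguments gm_deg {R}.

Section Regular.
Variable R : gradedRing.

Definition reg_deg (k : int) : set R^o :=
  if k is Posz n then gr_deg R n else [set 0].

Lemma reg_grading : is_grading reg_deg.
Proof.
have [sub gen free] := gr_grading R; split.
- case=> n /=; first exact: sub.
  by split=> // x y /= -> ->; rewrite subr0.
- move=> x; have [s [c [us cG ->]]] := gen x.
  exists (map Posz s), (fun k => if k is Posz n then c n else 0); split.
  + by rewrite map_inj_uniq// => a b [].
  + by case.
  + by rewrite big_map.
move=> s c us cG s0 j js.
case: j js => [n|n] js; last exact: (cG (Negz n)).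
pose g (k : int) : option nat := if k is Posz n then Some n else None.
have gK : ocancel g Posz by case.
have us' : uniq (pmap g s) by rewrite (pmap_uniq gK).
apply: (free (pmap g s) (fun n => c (Posz n)) us') => //.
- by move=> i; exact: (cG (Posz i)).
- rewrite -[RHS]s0; elim: (s) => [|[k|k] t IH]; first by rewrite !big_nil.
    by rewrite /= !big_cons IH.
  by rewrite /= big_cons (cG (Negz k)) add0r.
- by rewrite mem_pmap; apply/mapP; exists (Posz n).
Qed.

Lemma reg_degZ i k (a : R) (x : R^o) :
  gr_deg R i a -> reg_deg k x -> reg_deg (i%:Z + k) (a *: x).
Proof.
case: k => [k|k] ia /=; first exact: gr_degM.
move=> ->; rewrite scaler0; case: (_ + _) => //= n.
by have [/(_ n)[]] := gr_grading R.
Qed.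

(* [R] as a graded module over itself *)
Definition reg_module : gradedModule R := GradedModule reg_grading reg_degZ.

End Regular.

Section LocalCohomology.
Variable R : gradedRing.
Implicit Types M N E : gradedModule R.

Definition graded_map M N (f : M -> N) : Prop :=
  forall k x, gm_deg M k x -> gm_deg N k (f x).

(* injective object of the category of graded modules and degree-0 maps *)
Definition graded_injective E : Prop :=
  forall M N (j : {linear M -> N}) (f : {linear M -> E}),
    graded_map j -> injective j -> graded_map f ->
    exists2 g : {linear N -> E}, graded_map g & forall x, g (j x) = f x.

Record injective_resolution M := InjectiveResolution {
  res_obj : nat -> gradedModule R;
  res_aug : {linear M -> res_obj 0%N};
  res_d : forall i, {linear res_obj i -> res_obj i.+1};
  res_aug_graded : graded_map res_aug;
  res_d_graded : forall i, graded_map (res_d i);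
  res_injective : forall i, graded_injective (res_obj i);
  res_aug_inj : injective res_aug;
  res_exact0 : forall x, res_d 0%N x = 0 <-> exists y, x = res_aug y;
  res_exact : forall i x, res_d i.+1 x = 0 <-> exists y, x = res_d i y }.

Definition torsion (J : set R) M : set M :=
  [set x | exists k : nat, forall a, ideal_pow J k a -> a *: x = 0].

Section Cohomology.
Variables (J : set R) (M : gradedModule R) (E : injective_resolution M).

(* the degree-n part of the complex Gamma_J(E) *)
Definition gamma_chain (i : nat) (n : int) : set (res_obj E i) :=
  torsion J (M := res_obj E i) `&` gm_deg (res_obj E i) n.
Arguments gamma_chain : clear implicits.

Definition gamma_cocycle (i : nat) (n : int) : set (res_obj E i) :=
  gamma_chain i n `&` [set x | res_d E i x = 0].

Definition gamma_coboundary (i : nat) (n : int) : set (res_obj E i) :=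
  match i return set (res_obj E i) with
  | 0 => [set 0]
  | j.+1 => [set res_d E j y | y in gamma_chain j n]
  end.

End Cohomology.
Arguments gamma_chain J {M} E i n.
Arguments gamma_cocycle J {M} E i n.
Arguments gamma_coboundary J {M} E i n.

(* H^i_J(M)_n != 0, where H^i_J is the i-th right derived functor of Gamma_J *)
(* on graded modules.  There are enough graded injectives and any two        *)
(* injective resolutions of M are homotopy equivalent, so that this is       *)
(* non-vanishing for one, equivalently every, resolution E.                  *)
Definition local_cohomology_neq0 (J : set R) M (i : nat) (n : int) : Prop :=
  forall E : injective_resolution M,
    ~ (gamma_cocycle J E i n `<=` gamma_coboundary J E i n).

Definition a_inv (i : nat) : \bar int :=
  zsup [set n%:E | n in
    [set n : int | local_cohomology_neq0 (irrelevant_ideal R) (reg_module R) i n]].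

Definition regularity : \bar int :=
  zsup [set (a_inv i + i%:Z%:E)%E | i in [set: nat]].

End LocalCohomology.
Arguments regularity : clear implicits.

Section Rees.
Variables (A : comNzRingType) (I : set A).

Lemma ideal_gen_ideal (S : set A) : is_ideal (ideal_gen S).
Proof.
split=> [J [[]]//|x y Jx Jy J JS|a x Jx J JS].
  by have [[_ JD _] _] := JS; apply: JD; [exact: Jx|exact: Jy].
by have [[_ _ JM] _] := JS; apply: JM; exact: Jx.
Qed.

Lemma ideal_pow_ideal n : is_ideal (ideal_pow I n).
Proof. by case: n => [|n]; [split | exact: ideal_gen_ideal]. Qed.

Lemma ideal_powM m n x y :
  ideal_pow I m x -> ideal_pow I n y -> ideal_pow I (m + n) (x * y).
Proof.
move=> + ny; elim: m x => [|m IH] x /=.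
  by move=> _; have [_ _] := ideal_pow_ideal n; apply.
have [p0 pD pM] := ideal_pow_ideal (m.+1 + n).
move/(_ [set z | ideal_pow I (m.+1 + n) (z * y)]); apply; split.
- split=> [|u v Hu Hv|a u Hu] /=; first by rewrite mul0r; exact: p0.
  + by rewrite mulrDl; exact: pD.
  + by rewrite -mulrA; exact: pM.
- move=> _ [u Iu [v mv <-]] J [_]; apply.
  by exists u => //; exists (v * y); [exact: IH | rewrite mulrA].
Qed.

(* R(I) is realized as the subring of the p(t) in A[t] whose coefficient of  *)
(* t^n lies in I^n.                                                          *)
Definition rees_pred : {pred {poly A}} :=
  fun p => `[< forall n, ideal_pow I n p`_n >].

Lemma rees_subring : subring_closed rees_pred.
Proof.
split=> [|p q /asboolP pI /asboolP qI|p q /asboolP pI /asboolP qI].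
- apply/asboolP => n; rewrite coef1; case: n => [//|n].
  by have [] := ideal_pow_ideal n.+1.
- apply/asboolP => n; rewrite coefB -mulN1r.
  by have [_ JD JM] := ideal_pow_ideal n; apply: JD => //; apply: JM.
- apply/asboolP => n; rewrite coefM.
  have [J0 JD _] := ideal_pow_ideal n.
  apply: (big_ind (ideal_pow I n)) => // i _.
  have := ideal_powM (pI i) (qI (n - i)%N).
  by rewrite subnKC// -ltnS.
Qed.

HB.instance Definition _ :=
  GRing.isSubringClosed.Build {poly A} rees_pred rees_subring.

Definition rees_type := {p : {poly A} | p \in rees_pred}.
HB.instance Definition _ := SubType.on rees_type.
HB.instance Definition _ := Choice.on rees_type.
HB.instance Definition _ := [SubChoice_isSubComNzRing of rees_type by <:].

Definition rees_deg (n : nat) : set rees_type :=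
  [set p | exists a : A, val p = a *: 'X^n].

Lemma rees_deg_coef n (p : rees_type) k :
  rees_deg n p -> k != n -> (val p)`_k = 0.
Proof. by move=> [a ->] kn; rewrite coefZ coefXn (negbTE kn) mulr0. Qed.

Lemma rees_homP (p : rees_type) n : (val p)`_n *: 'X^n \in rees_pred.
Proof.
apply/asboolP => k; rewrite coefZ coefXn; case: eqP => [->|_].
  by rewrite mulr1; have /asboolP := valP p.
by rewrite mulr0; have [] := ideal_pow_ideal k.
Qed.

Lemma rees_grading : is_grading rees_deg.
Proof.
split.
- move=> j; split; first by exists 0; rewrite scale0r raddf0.
  by move=> x y [a xa] [b yb]; exists (a - b); rewrite raddfB/= xa yb scalerBl.
- move=> p; exists (iota 0 (size (val p))).
  exists (fun n => exist (fun q => q \in rees_pred) _ (rees_homP p n) : rees_type); split.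
  + exact: iota_uniq.
  + by move=> j; exists (val p)`_j.
  + apply: val_inj; rewrite raddf_sum/= -[LHS]coefK poly_def.
    by rewrite -(big_mkord xpredT (fun i => (val p)`_i *: 'X^i)) /index_iota subn0.
- move=> s c us cG s0 j js; apply: val_inj; apply/polyP => k.
  rewrite raddf0 coef0; have [->|kj] := eqVneq k j; last first.
    exact: rees_deg_coef (cG j) kj.
  have /(congr1 (fun p : rees_type => (val p)`_j)) := s0.
  rewrite raddf_sum/= coef_sum (bigD1_seq j)//= big1 ?addr0 ?coef0//.
  by move=> i ij; apply: rees_deg_coef (cG i) _; rewrite eq_sym.
Qed.

Lemma rees_deg1 : rees_deg 0 1.
Proof. by exists 1; rewrite scale1r expr0 rmorph1. Qed.

Lemma rees_degM i j x y :
  rees_deg i x -> rees_deg j y -> rees_deg (i + j) (x * y).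
Proof.
move=> [a xa] [b yb]; exists (a * b).
by rewrite rmorphM/= xa yb -scalerAl -scalerAr scalerA exprD.
Qed.

Definition rees : gradedRing := GradedRing rees_grading rees_deg1 rees_degM.

End Rees.

(* Main.v *)
Require Import Defs.
From HB Require Import structures.
From mathcomp Require Import all_boot all_order all_algebra.
From mathcomp Require Import boolp classical_sets constructive_ereal.
From mathcomp Require Import zify.

Set Implicit Arguments.
Unset Strict Implicit.
Unset Printing Implicit Defensive.

Import Order.TTheory GRing.Theory Num.Theory.
Local Open Scope classical_set_scope.
Local Open Scope ring_scope.

(** Write R for the Rees algebra R(I), realized inside A[t], and J for R_+.

    The proof rests on the containment of the quotient of the Ratliff-Rush
    closure of I^n by I^n in H^1_J(R)_n, for n >= 1.  If a lies in the
    Ratliff-Rush closure of I^n, then a I^k is contained in I^(n+k) for some k,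
    which says exactly that J^k sends z = a t^n into R.  Given a graded injective resolution E of
    R, the augmentation R -> E^0 extends to a graded map g : A[t] -> E^0, and
    d(g z) is a J-torsion cocycle of degree n in E^1.  If H^1_J(R)_n vanishes,
    then d(g z) = d y for some torsion y, so g z - y comes from some w in R.  A
    high power of x t, where x in I is a nonzerodivisor, kills y and maps z into
    R, where the augmentation is injective; hence it kills z - w, and z = w is
    in R, that is, a is in I^n ([ratliff_rush_eq_of_cohomology]).

    By definition of the regularity, H^1_J(R)_n = 0 as soon as n >= reg R, so
    the closure of I^n is I^n for all n >= max(reg R, 1); this is (ii).
    For (i), the powers I^t multiply the closure of I^n into the closure of
    I^(n+t), which is I^(n+t) once n + t >= reg R; the other inclusion holds
    for all t. *)

Arguments gamma_cocycle {R} J {M} E i n.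
Arguments gamma_coboundary {R} J {M} E i n.

(** * Suprema and infima in the extended integers *)

Lemma zsup_ub (S : set (\bar int)) x : S x -> (x <= zsup S)%E.
Proof.
move=> Sx; rewrite /zsup /supremum; case: eqP => [S0|_]; first by move: Sx; rewrite S0.
by case: xgetP => [y _ [ub _]|no]; [exact: ub|case: (supremums_neq0 S) => y /no].
Qed.

Lemma zinf_lb (S : set (\bar int)) x : S x -> (zinf S <= x)%E.
Proof.
move=> Sx; rewrite /zinf /infimum; case: eqP => [S0|_]; first by move: Sx; rewrite S0.
by case: xgetP => [y _ [lb _]|no]; [exact: lb|case: (infimums_neq0 S) => y /no].
Qed.

(** * Regularity and vanishing of the first local cohomology *)

(** If H^1_n were nonzero then n <= a_1, so n + 1 <= a_1 + 1 <= reg R <= n.  The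
    negation of [local_cohomology_neq0] provides one resolution that computes
    H^1_n = 0, and a single resolution suffices for the argument below. *)
Lemma cohomology1_vanishing (R : gradedRing) (n : int) :
  (regularity R <= n%:E)%E ->
  exists E : injective_resolution (reg_module R),
    gamma_cocycle (irrelevant_ideal R) E 1 n
      `<=` gamma_coboundary (irrelevant_ideal R) E 1 n.
Proof.
move=> regn; apply: contrapT => noE.
have nz : local_cohomology_neq0 (irrelevant_ideal R) (reg_module R) 1 n.
  by move=> E sub; apply: noE; exists E.
have a1 : (n%:E <= a_inv R 1)%E by apply: zsup_ub; exists n.
have : (a_inv R 1 + 1%:Z%:E <= n%:E)%E.
  by apply: le_trans regn; apply: zsup_ub; exists 1%N.
case: (a_inv R 1) a1 => [b|//|//]; rewrite -EFinD !lee_fin => nb bn.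
by have := le_trans bn nb; rewrite -subr_ge0 opprD addNKr.
Qed.

(** * Powers of ideals and the Ratliff-Rush closure *)

Section Powers.
Variables (A : comNzRingType) (I : set A).

Lemma ideal_gen_min (S K : set A) : is_ideal K -> S `<=` K -> ideal_gen S `<=` K.
Proof. by move=> Kid SK x; apply. Qed.

Lemma sub_ideal_gen (S : set A) : S `<=` ideal_gen S.
Proof. by move=> x Sx K [_]; exact. Qed.

Lemma colon_ideal (K : set A) y : is_ideal K -> is_ideal [set x | K (x * y)].
Proof.
case=> K0 KD KM; split=> [|u v Ku Kv|a u Ku] /=; first by rewrite mul0r.
  by rewrite mulrDl; exact: KD.
by rewrite -mulrA; exact: KM.
Qed.

Lemma ideal_powX (J : set A) x k : J x -> ideal_pow J k (x ^+ k).
Proof.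
move=> Jx; elim: k => [//|k IH]; rewrite exprS; apply: sub_ideal_gen.
by exists x => //; exists (x ^+ k).
Qed.

(** I^(k+l) is generated by I^k I^l; the universal form is convenient because
    ideals such as {x | x y in K} can be fed to it. *)
Lemma ideal_powD_min (K : set A) k l : is_ideal K ->
  (forall x y, ideal_pow I k x -> ideal_pow I l y -> K (x * y)) ->
  ideal_pow I (k + l) `<=` K.
Proof.
elim: k K => [|k IH] K Kid KP; first by move=> y Iy; rewrite -[y]mul1r; exact: KP.
rewrite addSn; apply: ideal_gen_min => // _ [u Iu [v Iv <-]]; rewrite mulrC.
apply: (IH [set z | K (z * u)] _ _ v Iv); first exact: colon_ideal.
move=> x y Ix Iy /=; rewrite mulrAC; apply: KP => //.
by rewrite mulrC; apply: sub_ideal_gen; exists u => //; exists x.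
Qed.

Lemma ideal_pow_pow n k : ideal_pow (ideal_pow I n) k = ideal_pow I (n * k).
Proof.
elim: k => [|k IH]; first by rewrite muln0.
rewrite mulnS /= /ideal_mul IH; apply/seteqP; split.
  apply: ideal_gen_min; first exact: ideal_pow_ideal.
  by move=> _ [u Iu [v Iv <-]]; exact: ideal_powM.
apply: ideal_powD_min; first exact: ideal_gen_ideal.
by move=> x y Ix Iy; apply: sub_ideal_gen; exists x => //; exists y.
Qed.

(** Since I^l = I^k I^(l-k), only the factor in I^k has to absorb a. *)
Lemma colon_pow_mono n k l : (k <= l)%N ->
  colon (ideal_pow I (n + k)) (ideal_pow I k)
    `<=` colon (ideal_pow I (n + l)) (ideal_pow I l).
Proof.
move=> kl a aP y; rewrite -(subnKC kl) addnA mulrC.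
move: y; apply: ideal_powD_min; first exact/colon_ideal/ideal_pow_ideal.
by move=> x y Ix Iy /=; rewrite mulrC mulrA; apply: ideal_powM => //; exact: aP.
Qed.

(** The powers (I^n)^k = I^(nk) are cofinal among the powers of I because n > 0,
    so that the union in the definition may run over all exponents. *)
Lemma ratliff_rush_powP n a : (0 < n)%N ->
  ratliff_rush (ideal_pow I n) a <->
  exists k, colon (ideal_pow I (n + k)) (ideal_pow I k) a.
Proof.
move=> n0; split=> [[k _]|[k aP]].
  by rewrite !ideal_pow_pow mulnS => aP; exists (n * k)%N.
exists k.+1 => //; rewrite !ideal_pow_pow mulnS.
(* The exponent must be positive and n times it at least k: k + 1 will do. *)
by apply: colon_pow_mono aP; rewrite (leq_trans (leqnSn k))// leq_pmull.
Qed.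

Lemma ratliff_rush_powM n t a y : (0 < n)%N ->
  ratliff_rush (ideal_pow I n) a -> ideal_pow I t y ->
  ratliff_rush (ideal_pow I (n + t)) (a * y).
Proof.
move=> n0 /(ratliff_rush_powP _ n0)[k aP] Iy.
apply/ratliff_rush_powP; first by rewrite addn_gt0 n0.
exists k => v Iv; rewrite mulrAC addnAC.
by apply: ideal_powM => //; exact: aP.
Qed.

Lemma sub_ratliff_rush_pow n : ideal_pow I n `<=` ratliff_rush (ideal_pow I n).
Proof.
move=> a Ia; exists 1%N => // y Jy.
have := @ideal_powM _ (ideal_pow I n) 1 1 a y; apply => //.
by rewrite ideal_pow_pow muln1.
Qed.

End Powers.

(** * The polynomial ring as a graded module over the Rees algebra *)

(** An alias of [{poly A}]: its module structure depends on I, through the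
    inclusion of the Rees algebra in A[t]. *)
Definition poly_rees (A : comNzRingType) (I : set A) : Type := {poly A}.

Section PolyRees.
Variables (A : comNzRingType) (I : set A).
Local Notation R := (rees I).
Local Notation P := (poly_rees I).

HB.instance Definition _ := GRing.Zmodule.on P.

(** The inclusion of R in A[t], stated on the ring underlying [rees I] so that
    its morphism structures are found for elements of that type. *)
Definition rees_val (p : R) : {poly A} := val (p : rees_type I).

Fact rees_val_is_zmod_morphism : zmod_morphism rees_val.
Proof. by move=> p q; rewrite /rees_val raddfB. Qed.

Fact rees_val_is_monoid_morphism : monoid_morphism rees_val.
Proof. by split=> [|p q]; [exact: rmorph1|exact: (rmorphM (val : rees_type I -> _))]. Qed.

HB.instance Definition _ := GRing.isZmodMorphism.Build R {poly A} rees_val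
  rees_val_is_zmod_morphism.
HB.instance Definition _ := GRing.isMonoidMorphism.Build R {poly A} rees_val
  rees_val_is_monoid_morphism.

Lemma rees_val_coef (p : R) n : ideal_pow I n (rees_val p)`_n.
Proof. by have /asboolP := valP (p : rees_type I). Qed.

Definition poly_rees_scale (p : R) (q : P) : P := (rees_val p * q : {poly A}).

Fact poly_rees_scaleA p q v :
  poly_rees_scale p (poly_rees_scale q v) = poly_rees_scale (p * q) v.
Proof. by rewrite /poly_rees_scale rmorphM mulrA. Qed.

Fact poly_rees_scale1 : left_id 1 poly_rees_scale.
Proof. by move=> v; rewrite /poly_rees_scale rmorph1 mul1r. Qed.

Fact poly_rees_scaleDr : right_distributive poly_rees_scale +%R.
Proof. by move=> p u v; rewrite /poly_rees_scale mulrDr. Qed.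

Fact poly_rees_scaleDl v : {morph poly_rees_scale^~ v : p q / p + q}.
Proof. by move=> p q; rewrite /poly_rees_scale rmorphD mulrDl. Qed.

HB.instance Definition _ := GRing.Zmodule_isLmodule.Build R P
  poly_rees_scaleA poly_rees_scale1 poly_rees_scaleDr poly_rees_scaleDl.

Definition poly_rees_deg (k : int) : set P :=
  if k is Posz n then [set q | exists a : A, q = a *: 'X^n :> {poly A}]
  else [set 0].

Lemma poly_rees_deg_coef k q (i : nat) :
  poly_rees_deg k q -> Posz i != k -> (q : {poly A})`_i = 0.
Proof.
case: k => [n [a ->]|n -> _]; last by rewrite coef0.
by rewrite eqz_nat coefZ coefXn => /negbTE->; rewrite mulr0.
Qed.

Lemma poly_rees_grading : is_grading poly_rees_deg.
Proof.
split.
- case=> n /=; last by split=> // x y -> ->; rewrite subr0.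
  split; first by exists 0; rewrite scale0r.
  by move=> x y [a ->] [b ->]; exists (a - b); rewrite scalerBl.
- move=> q; exists (map Posz (iota 0 (size (q : {poly A})))).
  exists (fun k => if k is Posz n then (q : {poly A})`_n *: 'X^n else 0); split.
  + by rewrite map_inj_uniq ?iota_uniq// => ? ? [].
  + by case=> // n; exists (q : {poly A})`_n.
  + rewrite big_map -[LHS](@coefK A q) poly_def.
    by rewrite -(big_mkord xpredT (fun i => (q : {poly A})`_i *: 'X^i)) /index_iota subn0.
move=> s c us cG s0 [n|n] js; last exact: (cG (Negz n)).
apply/polyP => i; rewrite coef0.
have [->|ne] := eqVneq i n; last by apply: poly_rees_deg_coef (cG n) _.
have /(congr1 (fun p : {poly A} => p`_n)) := s0.
rewrite coef0 coef_sum (bigD1_seq (Posz n))//= big1 ?addr0//.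
by move=> k kn; apply: poly_rees_deg_coef (cG k) _; rewrite eq_sym.
Qed.

Lemma poly_rees_degZ i k (a : R) (x : P) :
  gr_deg R i a -> poly_rees_deg k x -> poly_rees_deg (i%:Z + k) (a *: x).
Proof.
case: k => [k|k] [u au] /=.
  move=> [v ->]; exists (u * v); rewrite /GRing.scale/= /poly_rees_scale /rees_val au.
  by rewrite -scalerAl -scalerAr scalerA exprD.
move=> ->; rewrite scaler0; case: (_ + _) => //= n.
by exists 0; rewrite scale0r.
Qed.

Definition poly_rees_module : gradedModule R :=
  @GradedModule R P poly_rees_deg poly_rees_grading poly_rees_degZ.

(** The inclusion of R in A[t] again, now as a map of graded modules: this is
    the monomorphism along which maps to graded injectives are extended. *)
Definition rees_incl (p : reg_module R) : poly_rees_module := rees_val p.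

Fact rees_incl_is_linear : linear rees_incl.
Proof. by move=> a u v; rewrite /rees_incl raddfD. Qed.

HB.instance Definition _ := GRing.isLinear.Build R (reg_module R)
  poly_rees_module *:%R rees_incl rees_incl_is_linear.

Lemma rees_incl_graded : graded_map rees_incl.
Proof. by case=> n x; [|move=> ->; rewrite linear0]. Qed.

Lemma rees_incl_inj : injective rees_incl.
Proof. exact: val_inj. Qed.

(** * The irrelevant ideal of the Rees algebra *)

Lemma irrelevant_coef0 (p : R) :
  irrelevant_ideal R p -> (rees_val p)`_0 = 0.
Proof.
move: p; apply: (@ideal_gen_min R).
  split=> [|x y /= x0 y0|a x /= x0]; first by rewrite raddf0 coef0.
    by rewrite raddfD/= coefD x0 y0 addr0.
  by rewrite rmorphM/= coef0M x0 mulr0.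
by move=> p [n /= n0 pn]; apply: rees_deg_coef pn _; rewrite eq_sym -lt0n.
Qed.

Lemma irrelevant_pow_coef k (p : R) j :
  ideal_pow (irrelevant_ideal R) k p -> (j < k)%N ->
  (rees_val p)`_j = 0.
Proof.
move=> + jk.
suff : ideal_pow (irrelevant_ideal R) k `<=`
    [set p : R | forall j, (j < k)%N -> (rees_val p)`_j = 0].
  by move=> sub /sub; apply.
elim: k {j jk} => [//|k IH]; apply: (@ideal_gen_min R).
  split=> [j _|x y x0 y0 j jk|a x x0 j jk] /=; first by rewrite raddf0 coef0.
    by rewrite raddfD/= coefD x0// y0// addr0.
  rewrite rmorphM/= coefM big1// => i _.
  by rewrite x0 ?mulr0// (leq_ltn_trans (leq_subr _ _)).
move=> _ [u /irrelevant_coef0 u0 [v /IH v0 <-]] j jk.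
rewrite rmorphM/= coefM big1// => -[[|i] ij] _ /=; first by rewrite u0 mul0r.
by rewrite v0 ?mulr0//; lia.
Qed.

(** Elements of J^k live in degrees at least k, where multiplication by a
    raises the I-adic order by n. *)
Lemma irrelevant_pow_mul_rees n k a (p : R) :
  colon (ideal_pow I (n + k)) (ideal_pow I k) a ->
  ideal_pow (irrelevant_ideal R) k p ->
  rees_val p * (a *: 'X^n) \in rees_pred I.
Proof.
move=> aP Jp; apply/asboolP => j; have [I0 _ _] := ideal_pow_ideal I j.
rewrite -scalerAr coefZ coefMXn; case: ltnP => [_|nj]; first by rewrite mulr0.
have [jk|kj] := ltnP (j - n) k.
  by rewrite (irrelevant_pow_coef Jp jk) mulr0.
rewrite -{1}(subnKC nj); apply: (colon_pow_mono kj aP).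
exact: rees_val_coef.
Qed.

Fact polyZX_rees_pred x : I x -> x *: 'X \in rees_pred I.
Proof.
move=> Ix; apply/asboolP => -[|[|j]] //.
  rewrite coefZ coefX/= mulr1; apply: sub_ideal_gen.
  by exists x => //; exists 1 => //; rewrite mulr1.
by rewrite coefZ coefX/= mulr0; have [] := ideal_pow_ideal I j.+2.
Qed.

End PolyRees.

Lemma lreg_polyZX (A : comNzRingType) (x : A) :
  GRing.lreg x -> GRing.lreg (x *: 'X).
Proof.
move=> xreg p q /(congr1 (fun r : {poly A} => fun i => r`_i.+1)) pq.
apply/polyP => i; apply: xreg.
by have := congr1 (@^~ i) pq; rewrite /= -!scalerAl !coefZ !coefXM.
Qed.

(** * The Ratliff-Rush closure and the first local cohomology module *)

(** The closure of I^n modulo I^n embeds in H^1_J(R)_n, by the connecting map of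
    0 -> R -> A[t] -> A[t]/R -> 0; the proof chases one element through it. *)
Lemma ratliff_rush_eq_of_cohomology (A : comNzRingType) (I : set A) (n : nat)
    (E : injective_resolution (reg_module (rees I))) :
  regular_ideal I -> (0 < n)%N ->
  gamma_cocycle (irrelevant_ideal (rees I)) E 1 n
    `<=` gamma_coboundary (irrelevant_ideal (rees I)) E 1 n ->
  ratliff_rush (ideal_pow I n) = ideal_pow I n.
Proof.
move=> [_ [x Ix xreg]] n0 H1; apply/seteqP; split; last exact: sub_ratliff_rush_pow.
move=> a /(ratliff_rush_powP _ _ n0)[k aP].
pose J := irrelevant_ideal (rees I).
have [g g_graded gE] := @res_injective _ _ E 0%N _ _ (@rees_incl A I) (res_aug E)
  (@rees_incl_graded A I) (@rees_incl_inj A I) (@res_aug_graded _ _ E).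
pose z : poly_rees_module I := a *: 'X^n.
have gJ (p : rees I) : ideal_pow J k p ->
    exists2 w : reg_module (rees I), rees_incl w = p *: z & g (p *: z) = res_aug E w.
  move=> Jp; pose w : rees_type I := exist (fun q => q \in rees_pred I) _ (irrelevant_pow_mul_rees aP Jp).
  by exists w => //; rewrite -gE.
(* J^k d(g z) = d(g(J^k z)) lies in d(im aug) = 0, so d(g z) is torsion. *)
have [y [[l yl] _] dy] : gamma_coboundary J E 1 n (res_d E 0 (g z)).
  apply: H1; split; first split.
  - exists k => p Jp; rewrite -linearZ -linearZ /=.
    have [w _ ->] := gJ p Jp.
    by apply/(@res_exact0 _ _ E); exists w.
  - by apply: (@res_d_graded _ _ E); apply: g_graded; exists a.
  - by apply/(@res_exact _ _ E); exists (g z).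
have [w wE] : exists w, g z - y = res_aug E w.
  by apply/(@res_exact0 _ _ E); rewrite linearB dy subrr.
pose xt : rees I := (exist (fun q => q \in rees_pred I) _ (polyZX_rees_pred Ix) : rees_type I).
have Jxt : J xt.
  by apply: sub_ideal_gen; exists 1%N => //; exists x.
(* The exponent k + l puts p in J^k, which maps z into R, and in J^l, which
   kills y. *)
pose p : rees I := xt ^+ (k + l).
have pk : ideal_pow J k p.
  rewrite /p exprD mulrC; have [_ _] := @ideal_pow_ideal (rees I) J k; apply.
  exact: ideal_powX.
have pl : ideal_pow J l p.
  rewrite /p exprD; have [_ _] := @ideal_pow_ideal (rees I) J l; apply.
  exact: ideal_powX.
have [v vz gv] := gJ p pk.
have pw : v = p *: w.
  apply: (res_aug_inj (i0 := E)); rewrite linearZ /= -wE scalerBr (yl p pl) subr0.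
  by rewrite -linearZ gv.
have zw : (z : {poly A}) = rees_val w.
  have preg : GRing.lreg (rees_val p).
    by rewrite rmorphXn; apply: lregX; exact: lreg_polyZX.
  by apply: preg; have := vz; rewrite pw linearZ.
have := rees_val_coef w n.
by rewrite -zw coefZ coefXn eqxx mulr1.
Qed.

Lemma ratliff_rush_eq_of_regularity (A : comNzRingType) (I : set A) (n : nat) :
  regular_ideal I -> (0 < n)%N -> (regularity (rees I) <= n%:Z%:E)%E ->
  ratliff_rush (ideal_pow I n) = ideal_pow I n.
Proof.
move=> regI n0 /cohomology1_vanishing[E H1].
exact: ratliff_rush_eq_of_cohomology H1.
Qed.

Theorem proposition2p1 (A : comNzRingType) (m : set A)
    (noethA : noetherian A) (localA : local_ring m) (dimA : (0 < krull_dim A)%E)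
    (I : set A) (regI : regular_ideal I) :
  (forall n t : nat, (1 <= n)%N ->
     (regularity (rees I) - n%:Z%:E <= t%:Z%:E)%E ->
     ratliff_rush (ideal_pow I n)
       = colon (ideal_pow I (n + t)) (ideal_pow I t)) /\
  (s_star I <= maxe (regularity (rees I)) 1)%E.
Proof.
split=> [n t n0 regnt|].
  have nt0 : (0 < n + t)%N by rewrite addn_gt0 n0.
  have regle : (regularity (rees I) <= (n + t)%:Z%:E)%E.
    move: regnt; case: (regularity _) => [r|//|_]; last exact: leNye.
    by rewrite -EFinB !lee_fin lerBlDl PoszD.
  apply/seteqP; split=> a aP; last by apply/ratliff_rush_powP => //; exists t.
  (* a y lies in the closure of I^(n+t), which is I^(n+t). *)
  move=> y Iy; rewrite -(ratliff_rush_eq_of_regularity regI nt0 regle).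
  exact: ratliff_rush_powM.
case regE : (regularity (rees I)) => [r| |]; first last.
- rewrite max_r ?leNye//; apply: zinf_lb; exists 1%N; split=> // n n0.
  by apply: ratliff_rush_eq_of_regularity => //; rewrite regE leNye.
- by rewrite max_l ?leey.
pose b := maxn `|Num.max r 0|%N 1.
have bE : maxe r%:E 1%E = b%:Z%:E.
  by rewrite -EFin_max /b; congr EFin; lia.
rewrite bE; apply: zinf_lb; exists b; split=> //; first by rewrite leq_max orbT.
move=> n bn; apply: ratliff_rush_eq_of_regularity => //.
  by apply: leq_trans bn; rewrite leq_max orbT.
rewrite regE; apply: (@le_trans _ _ b%:Z%:E); last by rewrite lee_fin.
by rewrite -bE le_max lexx.
Qed.
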